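(* Let $\{e_i:i\in\Theta\}$ and $\{f_i:i\in\Theta\}$ be two orthonormal bases of $H$, and let $P_\omega(x)=\sum_{i\in\Theta}\omega_i\,l_{e_i}^*xl_{e_i}$ and $P'_\omega(x)=\sum_{i\in\Theta}\omega_i\,l_{f_i}^*xl_{f_i}$ for $x\in B(\mathcal{F}(H))$. Then the peripheral Poisson boundaries $(P(P_\omega),\circ)$ and $(P(P'_\omega),\circ)$ are isomorphic as C*-algebras.
   Context: $H$ is a separable Hilbert space whose orthonormal bases are indexed by $\Theta=\{1,\dots,n\}$ with $n>1$, or $\Theta=\mathbb{N}$. $\mathcal{F}(H)=\bigoplus_{n\ge 0}H^{\otimes n}$ is the full Fock space, with $H^{\otimes 0}=\mathbb{C}\Omega$, $\Omega$ a unit (vacuum) vector. For $\xi\in H$, $l_\xi$ is the left creation operator on $\mathcal{F}(H)$, $l_\xi(\eta)=\xi\otimes\eta$ (with $l_\xi\Omega=\xi$). $\omega=(\omega_i)_{i\in\Theta}$ is a family of positive reals with $\sum_{i\in\Theta}\omega_i=1$. The maps $P_\omega,P'_\omega$ are normal unital completely positive maps on $B(\mathcal{F}(H))$. For a normal unital completely positive map $\tau$ on a von Neumann algebra $\mathcal{A}$ and $\lambda\in\mathbb{T}$ (unit circle), $E_\lambda(\tau)=\{x\in\mathcal{A}:\tau(x)=\lambda x\}$. The peripheral Poisson boundary $P(\tau)$ is the norm-closed linear span of $\bigcup_{\lambda\in\mathbb{T}}E_\lambda(\tau)$. It is known (Bhat–Kar–Talwar) that $P(\tau)$ is a unital C*-algebra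 with the norm and adjoint of $\mathcal{A}$, unit $1$, and the modified Choi–Effros product $\circ$, the unique norm-continuous bilinear map on $P(\tau)$ such that $x\circ y=\text{SOT-}\lim_{m\to\infty}(\lambda\mu)^{-m}\tau^m(xy)$ for $x\in E_\lambda(\tau)$, $y\in E_\mu(\tau)$. *)

(* Defs.v *)
From HB Require Import structures.
From mathcomp Require Import all_boot all_order all_algebra.
From mathcomp Require Import sesquilinear complex.
From mathcomp Require Import all_classical all_reals all_analysis.
Set Implicit Arguments.
Unset Strict Implicit.
Unset Printing Implicit Defensive.
Import Order.TTheory GRing.Theory Num.Theory numFieldNormedType.Exports.
Local Open Scope classical_set_scope.
Local Open Scope ring_scope.

(* The scalars are R[i]; norms take values in R[i] (nonnegative reals).
   The inner product is linear in its first argument and conjugate-linear in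
   the second. *)
HB.mixin Record CompleteNormedModule_isHilbert (R : realType) H
    of CompleteNormedModule R[i] H := {
  dotp : {dot H for Num.conj} ;
  sqr_norm_dotp : forall x : H, `|x| ^+ 2 = dotp x x }.

#[short(type="hilbertType")]
HB.structure Definition Hilbert (R : realType) :=
  { H of CompleteNormedModule R[i] H & CompleteNormedModule_isHilbert R H }.

Definition lspan (K : numFieldType) (V : lmodType K) (A : set V) : set V :=
  [set v | exists (n : nat) (c : 'I_n -> K) (a : 'I_n -> V),
    (forall i, A (a i)) /\ v = \sum_(i < n) c i *: a i].

(* Only the values of e on Theta matter. *)
Definition orthonormal_basis (R : realType) (H : hilbertType R)
    (Theta : set nat) (e : nat -> H) : Prop :=
  (forall i j, Theta i -> Theta j -> dotp (e i) (e j) = (i == j)%:R) /\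
  closure (lspan (e @` Theta)) = setT.

Section Operators.
Variables (R : realType) (F : hilbertType R).
Implicit Types S T : F -> F.

Definition bounded_op : set (F -> F) :=
  [set T | linear T /\ exists M : R[i], forall v, `|T v| <= M * `|v|].

Definition opnorm T : R :=
  sup [set complex.Re `|T v| | v in [set v | `|v| <= 1]].

(* There is at most one S as below, and exactly one when T is bounded. *)
Definition adjoint T : F -> F :=
  xget 0 [set S | forall u v, dotp (T u) v = dotp u (S v)].

Definition norm_closure (A : set (F -> F)) : set (F -> F) :=
  [set y | bounded_op y /\
    forall eps : R, 0 < eps -> exists2 x, A x & opnorm (y - x) < eps].

End Operators.

Section PeripheralPoissonBoundary.
Variables (R : realType) (F : hilbertType R).
(* A map on B(F), considered on bounded operators only. *)
Variable tau : (F -> F) -> (F -> F).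

Definition eigenoperators (lam : R[i]) : set (F -> F) :=
  [set x | bounded_op x /\ tau x = lam *: x].

Definition peripheral_boundary : set (F -> F) :=
  norm_closure (lspan (\bigcup_(lam in [set z : R[i] | `|z| = 1])
    eigenoperators lam)).

Local Notation P := peripheral_boundary.

Definition is_choi_effros (circ : (F -> F) -> (F -> F) -> (F -> F)) : Prop :=
  [/\ forall x y, P x -> P y -> P (circ x y),
      forall (a : R[i]) x x' y, P x -> P x' -> P y ->
        circ (a *: x + x') y = a *: circ x y + circ x' y,
      forall (a : R[i]) x y y', P x -> P y -> P y' ->
        circ x (a *: y + y') = a *: circ x y + circ x y',
      forall x y, P x -> P y -> forall eps : R, 0 < eps ->
        exists2 delta : R, 0 < delta & forall x' y', P x' -> P y' ->
          opnorm (x' - x) < delta -> opnorm (y' - y) < delta ->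
          opnorm (circ x' y' - circ x y) < eps
    & forall (lam mu : R[i]) x y, `|lam| = 1 -> `|mu| = 1 ->
        eigenoperators lam x -> eigenoperators mu y ->
        forall v, (lam * mu) ^- m *: iter m tau (x \o y) v @[m --> \oo]
          --> circ x y v].

(* For a normal unital completely positive tau, such a product exists (Bhat,
   Kar and Talwar), and it is unique on the boundary. *)
Definition choi_effros : (F -> F) -> (F -> F) -> (F -> F) :=
  xget (fun _ _ => 0) is_choi_effros.

End PeripheralPoissonBoundary.

(* The spaces of operators A and B carry their own products; sums, adjoints,
   units and norms are those of operators. *)
Definition cstar_isomorphic (R : realType) (F G : hilbertType R)
    (A : set (F -> F)) (circA : (F -> F) -> (F -> F) -> (F -> F))
    (B : set (G -> G)) (circB : (G -> G) -> (G -> G) -> (G -> G)) : Prop :=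
  exists Phi : (F -> F) -> (G -> G),
    set_bij A B Phi /\
    [/\ forall (a : R[i]) x y, A x -> A y ->
          Phi (a *: x + y) = a *: Phi x + Phi y,
        forall x y, A x -> A y -> Phi (circA x y) = circB (Phi x) (Phi y),
        forall x, A x -> Phi (adjoint x) = adjoint (Phi x),
        Phi id = id
      & forall x, A x -> opnorm (Phi x) = opnorm x].

Section Fock.
Variables (R : realType) (H F : hilbertType R).

(* F is the Hilbert space direct sum of the Hilbert tensor powers of H:
   tens [:: x1; ...; xn] is the elementary tensor x1 (x) ... (x) xn, tens [::]
   is the vacuum vector, and the n-th tensor power is the closed linear span of
   the tensors of n vectors.  The first condition gives the inner products of
   elementary tensors (whence their multilinearity), and the orthogonality of
   the different tensor powers. *)
Definition full_fock_space (tens : seq H -> F) : Prop :=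
  (forall s t, dotp (tens s) (tens t) =
     if size s == size t then \prod_(p <- zip s t) dotp p.1 p.2 else 0) /\
  closure (lspan (range tens)) = setT.

Variable tens : seq H -> F.

(* The elementary tensors being total, there is at most one T as below. *)
Definition left_creation (xi : H) : F -> F :=
  xget 0 [set T | bounded_op T /\ forall s, T (tens s) = tens (xi :: s)].

(* The series converges absolutely in operator norm, a fortiori pointwise. *)
Definition weighted_compression (Theta : set nat) (omega : nat -> R)
    (e : nat -> H) (x : F -> F) : F -> F :=
  fun v => lim (\sum_(0 <= i < m | i \in Theta) ((omega i)%:C)%C *:
    adjoint (left_creation (e i)) (x (left_creation (e i) v)) @[m --> \oo]).

End Fock.

(* Main.v *)
Require Import Defs.
From HB Require Import structures.
From mathcomp Require Import all_boot all_order all_algebra.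
From mathcomp Require Import sesquilinear complex.
From mathcomp Require Import all_classical all_reals all_analysis.
Import Order.TTheory GRing.Theory Num.Theory numFieldNormedType.Exports.
Local Open Scope classical_set_scope.
Local Open Scope ring_scope.

(* The unitary U of H with U e_i = f_i second-quantizes to a unitary W of the
   Fock space, W (x_1 (x) ... (x) x_n) = U x_1 (x) ... (x) U x_n.  It satisfies
   W l_{e_i} W* = l_{f_i}, so conjugation by W intertwines P_omega and
   P'_omega; it therefore carries eigenoperators to eigenoperators and transports
   the Choi-Effros product, which is unique by bilinearity and continuity.
   Both U and W, as well as the left creation operators, come from one fact:
   a family with dense span is carried isometrically onto any family with the
   same Gram matrix. *)

Set Implicit Arguments.
Unset Strict Implicit.

(** * Formal linear combinations over an indexed family *)

Section LinearCombinations.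
Context {K : numFieldType} {V : lmodType K}.

(** The coefficients form a list, independent of the family: the same list can be evaluated in two
    families, and concatenation realizes addition. *)
Definition lcomb {I : Type} (a : I -> V) (s : seq (K * I)) : V :=
  \sum_(p <- s) p.1 *: a p.2.

Lemma lcombP {I : Type} (a : I -> V) (k : K) (s t : seq (K * I)) :
  lcomb a ([seq (k * p.1, p.2) | p <- s] ++ t) = k *: lcomb a s + lcomb a t.
Proof.
rewrite /lcomb big_cat big_map scaler_sumr; congr (_ + _).
by apply: eq_bigr => p _; rewrite scalerA.
Qed.

Lemma lspan_range {I : Type} (a : I -> V) (v : V) :
  lspan (range a) v -> exists s, v = lcomb a s.
Proof.
move=> [n [c [x [xa ->]]]].
have /choice[k ak] : forall i, exists j, a j = x i.
  by move=> i; have [j _ <-] := xa i; exists j.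
exists [seq (c i, k i) | i <- index_enum 'I_n].
by rewrite /lcomb big_map; apply: eq_bigr => i _; rewrite ak.
Qed.

End LinearCombinations.

(** * Gram matrices and isometric extension *)

Section Hilbert.
Context {R : realType}.
Implicit Types E F : hilbertType R.

Lemma normE_dotp E (u : E) : `|u| = sqrtC (dotp u u).
Proof. by rewrite -sqr_norm_dotp sqrCK. Qed.

Lemma dotp_lcomb E I (a : I -> E) s t :
  dotp (lcomb a s) (lcomb a t) =
  \sum_(p <- s) \sum_(q <- t) p.1 * (q.1^* * dotp (a p.2) (a q.2)).
Proof.
rewrite /lcomb linear_sumlz; apply: eq_bigr => p _.
rewrite linear_sumr; apply: eq_bigr => q _.
by rewrite linearZl_LR linearZr_LR.
Qed.

Lemma norm_lcomb E F I (a : I -> E) (b : I -> F) s :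
  (forall i j, dotp (a i) (a j) = dotp (b i) (b j)) ->
  `|lcomb a s| = `|lcomb b s|.
Proof.
move=> ab; rewrite !normE_dotp !dotp_lcomb; congr sqrtC.
by apply: eq_bigr => p _; apply: eq_bigr => q _; rewrite ab.
Qed.

(** Polarization: the norm of [u + v] determines the real part of the inner product, and replacing
    [u] by ['i *: u] yields the imaginary part. *)
Lemma norm_preserving_dotp E F (U : E -> F) :
  linear U -> (forall v, `|U v| = `|v|) ->
  forall u v, dotp (U u) (U v) = dotp u v.
Proof.
move=> linU nU.
have UD u v : U (u + v) = U u + U v by have := linU 1 u v; rewrite !scale1r.
have U0 : U 0 = 0 by apply/eqP; rewrite -normr_eq0 nU normr0.
have UZ k v : U (k *: v) = k *: U v.
  by have := linU k v 0; rewrite !addr0 U0 addr0.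
have sym u v :
    dotp (U u) (U v) + (dotp (U u) (U v))^* = dotp u v + (dotp u v)^*.
  have : dotp (U (u + v)) (U (u + v)) = dotp (u + v) (u + v).
    by rewrite -!sqr_norm_dotp nU.
  rewrite UD !dnormD -!sqr_norm_dotp !nU => /addrI; exact.
move=> u v; have := sym ('i *: u) v.
rewrite UZ !linearZl_LR /= !rmorphM /= conjCi !mulNr -!mulrBr.
move=> /(mulfI (neq0Ci _)); move: (sym u v).
set x := dotp (U u) _; set y := dotp u v => xy1 xy2.
(* [xy1] equates [x + x^*] with [y + y^*] and [xy2] equates the differences; adding the two leaves
   twice [x] and twice [y]. *)
have : x *+ 2 = y *+ 2.
  by rewrite !mulr2n -{1}(subrK x^* x) -addrA (addrC x^*) xy1 xy2 addrACA addNr addr0.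
by move=> /eqP; rewrite -subr_eq0 -mulrnBl mulrn_eq0 /= subr_eq0 => /eqP.
Qed.

(** The approximant comes with its coefficient list, which can then be reused with another
    family. *)
Definition total_family E I (a : I -> E) :=
  forall (v : E) (eps : R[i]), 0 < eps -> exists s, `|v - lcomb a s| < eps.

Lemma total_family_range E I (a : I -> E) :
  closure (lspan (range a)) = setT -> total_family a.
Proof.
move=> clT v eps eps0; have : closure (lspan (range a)) v by rewrite clT.
move=> /(_ (ball v eps) (nbhsx_ballx v _ eps0)) [w [/lspan_range[s ->]]].
by rewrite -ball_normE /= => ws; exists s.
Qed.

Section GramIsometry.
Variables (E F : hilbertType R) (I : Type) (a : I -> E) (b : I -> F).
Hypothesis gram : forall i j, dotp (a i) (a j) = dotp (b i) (b j).
Hypothesis tot : total_family a.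

(* The closure of the graph of the linear map sending each [a i] to [b i]. *)
Let graph (v : E) (w : F) := forall eps : R[i], 0 < eps ->
  exists2 s, `|v - lcomb a s| < eps & `|w - lcomb b s| < eps.

(** Both entries of a pair are approximated through one list, and [norm_lcomb] gives the two
    approximants the same norm. *)
Let graph_norm v w : graph v w -> `|v| = `|w|.
Proof.
have le_norm (G G' : hilbertType R) (x y : G) (x' y' : G') e :
    `|x - y| < e / 2 -> `|x' - y'| < e / 2 -> `|y| = `|y'| -> `|x| <= `|x'| + e.
  move=> xy xy' yy'; rewrite -[x](subrK y) (le_trans (ler_normD _ _))// yy'.
  rewrite -[y'](subrK x') (le_trans (lerD (ltW xy) (ler_normD _ _)))//.
  by rewrite addrA addrC lerD2l [leRHS]splitr lerD2l distrC ltW.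
move=> vw; apply/eqP; rewrite eq_le; apply/andP; split;
  apply/ler_addgt0Pr => e e0; have /vw[s sv sw] : 0 < e / 2 by rewrite divr_gt0.
- exact: le_norm sv sw (norm_lcomb s gram).
- exact: le_norm sw sv (esym (norm_lcomb s gram)).
Qed.

Let graph_linear k v w v' w' :
  graph v w -> graph v' w' -> graph (k *: v + v') (k *: w + w').
Proof.
(* The tolerance is divided by [|k| + 1] rather than [|k|], which may vanish. *)
move=> vw vw' eps eps0; have k0 : 0 < `|k| + 1 by rewrite ltr_wpDl.
have /vw[s sv sw] : 0 < eps / 2 / (`|k| + 1) by rewrite !divr_gt0.
have /vw'[t tv tw] : 0 < eps / 2 by rewrite divr_gt0.
have main (G : hilbertType R) (x x' y y' : G) :
    `|x - y| < eps / 2 / (`|k| + 1) -> `|x' - y'| < eps / 2 ->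
    `|k *: x + x' - (k *: y + y')| < eps.
  move=> xy xy'; rewrite opprD addrACA -scalerBr (le_lt_trans (ler_normD _ _))//.
  rewrite (splitr eps) normrZ ler_ltD//.
  rewrite ltr_pdivlMr// in xy.
  by rewrite (le_trans _ (ltW xy))// mulrC ler_wpM2l// lerDl.
by exists ([seq (k * p.1, p.2) | p <- s] ++ t); rewrite lcombP main.
Qed.

(** The combinations of [b] whose lists approximate [v] in [a] generate a Cauchy filter, because
    equal Gram matrices give equal distances. Its limit, which exists by completeness, is the value
    at [v]. *)
Let graph_total v : exists w, graph v w.
Proof.
pose B (eps : R[i]) := [set w | exists2 s, `|v - lcomb a s| < eps & w = lcomb b s].
pose G := filter_from [set eps : R[i] | 0 < eps] B.
have GF : ProperFilter G.
  apply: filter_from_proper.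
    apply: filter_from_filter; first by exists 1 => /=.
    move=> e1 e2 /= e10 e20.
    (* [R[i]] is only partially ordered, but positive elements are real and hence comparable. *)
    have [le12|lt21] := real_leP (gtr0_real e10) (gtr0_real e20).
      exists e1 => // w [s sv ->]; split; exists s => //.
      exact: lt_le_trans sv _.
    exists e2 => // w [s sv ->]; split; exists s => //.
    exact: lt_trans sv _.
  by move=> e /= /(tot v)[s sv]; exists (lcomb b s), s.
have /cauchy_cvg Gcvg : cauchy G.
  apply: cauchy_exP => eps eps0.
  have e20 : 0 < eps / 2 by rewrite divr_gt0.
  have [s sv] := tot v e20; exists (lcomb b s); exists (eps / 2) => // _ [t tv ->].
  rewrite -ball_normE /=.
  (* The difference is itself the value of one list, so its norm can be computed in [a], where both
     combinations are near [v]. *)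
  have <- : lcomb b ([seq (-1 * p.1, p.2) | p <- t] ++ s) = lcomb b s - lcomb b t.
    by rewrite lcombP scaleN1r addrC.
  rewrite -(norm_lcomb _ gram) lcombP scaleN1r addrC.
  by rewrite (le_lt_trans (ler_distD v _ _))// (splitr eps) ltrD// distrC.
exists (lim G) => eps eps0.
have /Gcvg[d /= d0 Bd] : nbhs (lim G) (ball (lim G) eps) by exact: nbhsx_ballx.
(* One list has to serve both estimates: [d' <= eps] for [v], and [d' <= d] to stay in the filter
   set that lies within [eps] of the limit. *)
have [d' d'0 [d'd d'eps]] : exists2 d', 0 < d' & d' <= d /\ d' <= eps.
  have [le12|lt21] := real_leP (gtr0_real d0) (gtr0_real eps0).
    by exists d.
  by exists eps => //; split => //; exact: ltW.
have [s sv] := tot v d'0; exists s; first exact: lt_le_trans sv _.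
have : B d (lcomb b s) by exists s => //; exact: lt_le_trans sv _.
by move=> /Bd; rewrite -ball_normE.
Qed.

(** The closed graph is that of a function: two pairs over the same [v] differ by a pair with first
    entry 0, and [graph_norm] makes the second entry 0. Linearity follows from this uniqueness. *)
Lemma gram_isometry : exists U : E -> F, [/\ linear U,
  forall v, `|U v| = `|v| & forall i, U (a i) = b i].
Proof.
have fct v w w' : graph v w -> graph v w' -> w = w'.
  move=> vw /(graph_linear (-1)) /(_ vw) /graph_norm.
  rewrite !scaleN1r addNr normr0 => /esym/eqP.
  by rewrite normr_eq0 addrC subr_eq0 => /eqP.
have /choice[U UP] := graph_total; exists U; split.
- by move=> k u v; apply: fct (UP _) _; exact: graph_linear.
- by move=> v; apply/esym/graph_norm.
- move=> i; apply: fct (UP _) _ => eps eps0; exists [:: (1, i)];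
    by rewrite /lcomb big_seq1 scale1r subrr normr0.
Qed.

End GramIsometry.
End Hilbert.

(** * Bounded operators, operator norm and adjoints *)

Section BoundedOperators.
Context {R : realType}.
Implicit Types E F G : hilbertType R.

Lemma linear_fun0 F G (T : F -> G) : linear T -> T 0 = 0.
Proof.
by move=> /(_ (-1) 0 0); rewrite scaler0 add0r scaleN1r addNr.
Qed.

Lemma linear_funZ F G (T : F -> G) k u : linear T -> T (k *: u) = k *: T u.
Proof. by move=> T1; have := T1 k u 0; rewrite !addr0 (linear_fun0 T1) addr0. Qed.

Lemma linear_funB F G (T : F -> G) u v : linear T -> T (u - v) = T u - T v.
Proof. by move=> T1; have := T1 (-1) v u; rewrite !scaleN1r ![- _ + _]addrC. Qed.

(** The bound in [bounded_op] is an arbitrary element of [R[i]], unconstrained when [F] is the zero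
    space; its modulus is a bound as well. *)
Lemma bounded_op_ge0 F (T : F -> F) :
  bounded_op T -> exists2 M : R[i], 0 <= M & forall v, `|T v| <= M * `|v|.
Proof.
move=> [_ [M TM]]; exists `|M| => // v.
have Mv : 0 <= M * `|v| by rewrite (le_trans _ (TM v)).
by rewrite (le_trans (TM v))// -(ger0_norm Mv) normrM normr_id.
Qed.

Lemma bounded_op_lin F (k : R[i]) (S T : F -> F) :
  bounded_op S -> bounded_op T -> bounded_op (k *: S + T).
Proof.
move=> Sb Tb; split.
  have [[Sl _] [Tl _]] := (Sb, Tb).
  move=> c u v; rewrite /= !addrfctE !scalrfctE Sl Tl !scalerDr !scalerA.
  by rewrite addrACA (mulrC k).
have [[M M0 SM] [N N0 TN]] := (bounded_op_ge0 Sb, bounded_op_ge0 Tb).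
exists (`|k| * M + N) => v; rewrite addrfctE scalrfctE mulrDl.
by rewrite (le_trans (ler_normD _ _))// lerD// normrZ -mulrA ler_wpM2l.
Qed.

Lemma bounded_op0 F : bounded_op (0 : F -> F).
Proof.
split; first by move=> k u v /=; rewrite scaler0 addr0.
by exists 0 => v; rewrite normr0 mul0r.
Qed.

Lemma bounded_opB F (S T : F -> F) :
  bounded_op S -> bounded_op T -> bounded_op (S - T).
Proof. by move=> Sb Tb; rewrite addrC -scaleN1r; exact: bounded_op_lin. Qed.

Lemma bounded_op_comp F (S T : F -> F) :
  bounded_op S -> bounded_op T -> bounded_op (S \o T).
Proof.
move=> Sb Tb; split.
  have [[Sl _] [Tl _]] := (Sb, Tb).
  by move=> c u v /=; rewrite Tl Sl.
have [[M M0 SM] [N N0 TN]] := (bounded_op_ge0 Sb, bounded_op_ge0 Tb).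
exists (M * N) => v /=; rewrite (le_trans (SM _))// -mulrA.
by rewrite ler_wpM2l.
Qed.

(** Bridge between the norms of vectors, valued in [R[i]], and [opnorm], valued in [R]. *)
Lemma Re_norm_le (V W : normedModType R[i]) (v : V) (w : W) :
  (complex.Re `|v| <= complex.Re `|w|) = (`|v| <= `|w|).
Proof.
by rewrite lecE !(ger0_Im _) ?eqxx.
Qed.

Lemma opnorm_ge F (T : F -> F) (v : F) :
  bounded_op T -> `|v| <= 1 -> complex.Re `|T v| <= opnorm T.
Proof.
move=> Tb v1; have [M M0 TM] := bounded_op_ge0 Tb.
apply: ub_le_sup; last by exists v.
exists (complex.Re M) => _ [u /= u1 <-].
have : `|T u| <= M by rewrite (le_trans (TM u))// ler_piMr.
by rewrite lecE => /andP[].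
Qed.

Lemma opnorm_distC F (S T : F -> F) : opnorm (S - T) = opnorm (T - S).
Proof.
rewrite /opnorm; congr (sup _); apply: eq_imagel => v _.
by rewrite !addrfctE !opprfctE distrC.
Qed.

Lemma opnorm_small_eq F (S T : F -> F) : linear S -> linear T ->
  (forall (eps : R) v, 0 < eps -> `|v| <= 1 -> complex.Re `|S v - T v| <= eps) ->
  S = T.
Proof.
move=> Sl Tl ST; apply/funext => v.
have [->|v0] := eqVneq v 0; first by rewrite (linear_fun0 Sl) (linear_fun0 Tl).
have nv0 : `|v| != 0 by rewrite normr_eq0.
have ST1 u : `|u| <= 1 -> S u = T u.
  move=> u1; apply/eqP; rewrite -subr_eq0 -normr_le0 -(normr0 F) -Re_norm_le.
  rewrite normr0 /=; apply/ler_addgt0Pr => e e0; rewrite add0r; exact: ST.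
have : S (`|v|^-1 *: v) = T (`|v|^-1 *: v).
  by apply: ST1; rewrite normrZ normfV normr_id mulVf.
by rewrite (linear_funZ _ _ Sl) (linear_funZ _ _ Tl) => /(scalerI (invr_neq0 nv0)).
Qed.

Lemma dotp_nondegenerate F (u v : F) : (forall w, dotp w u = dotp w v) -> u = v.
Proof.
move=> uv; apply/eqP; rewrite -subr_eq0 -(dnorm_eq0 dotp).
by rewrite linearBr subr_eq0; apply/eqP; exact: uv.
Qed.

Lemma adjointE F (T S : F -> F) :
  (forall u v, dotp (T u) v = dotp u (S v)) -> adjoint T = S.
Proof.
move=> TS; apply: xget_subset1 => // S1 S2 TS1 TS2.
by apply/funext => v; apply: dotp_nondegenerate => w; rewrite -TS1 TS2.
Qed.

End BoundedOperators.

(** * Conjugation by a unitary between two spaces *)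

Section UnitaryConjugation.
Context {R : realType}.
Implicit Types F G : hilbertType R.

(** The inverse is carried as data because [adjoint] only concerns maps of one space to itself; that
    [W'] is W* becomes [dotp_unitary]. *)
Definition unitary_pair F G (W : F -> G) (W' : G -> F) :=
  [/\ linear W, forall v, `|W v| = `|v|, cancel W W' & cancel W' W].

Definition conj_op F G (W : F -> G) (W' : G -> F) (x : F -> F) : G -> G :=
  W \o x \o W'.

Lemma unitary_pair_sym F G (W : F -> G) W' :
  unitary_pair W W' -> unitary_pair W' W.
Proof.
move=> [Wl Wn WK W'K]; split => //.
  by move=> k u v; apply: (can_inj WK); rewrite W'K Wl !W'K.
by move=> v; rewrite -Wn W'K.
Qed.

Lemma isometry_cvg F G (W : F -> G) {T : Type} (A : set_system T) {_ : Filter A}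
    (u : T -> F) (l : F) : linear W -> (forall v, `|W v| = `|v|) ->
  u x @[x --> A] --> l -> W (u x) @[x --> A] --> W l.
Proof.
move=> Wl Wn /cvgrPdist_lt ul; apply/cvgrPdist_lt => e e0.
by near=> x; rewrite -(linear_funB _ _ Wl) Wn; near: x; exact: ul.
Unshelve. all: by end_near. Qed.

Section Conjugation.
Variables (F G : hilbertType R) (W : F -> G) (W' : G -> F).
Hypothesis WW' : unitary_pair W W'.
Local Notation Ad := (conj_op W W').
Local Notation Ad' := (conj_op W' W).

Lemma conj_opK : cancel Ad Ad'.
Proof.
by move: WW' => [_ _ WK _] x; apply/funext => v; rewrite /conj_op /= !WK.
Qed.

Lemma conj_op_lin (k : R[i]) x y : Ad (k *: x + y) = k *: Ad x + Ad y.
Proof.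
move: WW' => [Wl _ _ _]; apply/funext => v.
by rewrite /conj_op /= !addrfctE !scalrfctE /= Wl.
Qed.

Lemma conj_op0 : Ad 0 = 0.
Proof.
by move: WW' => [Wl _ _ _]; apply/funext => v; exact: linear_fun0.
Qed.

Lemma conj_opZ (k : R[i]) x : Ad (k *: x) = k *: Ad x.
Proof. by have := conj_op_lin k x 0; rewrite conj_op0 !addr0. Qed.

Lemma conj_opB x y : Ad (x - y) = Ad x - Ad y.
Proof. by rewrite addrC -scaleN1r conj_op_lin scaleN1r addrC. Qed.

Lemma conj_op_id : Ad id = id.
Proof. by move: WW' => [_ _ _ W'K]; apply/funext => v; exact: W'K. Qed.

Lemma conj_op_comp x y : Ad (x \o y) = Ad x \o Ad y.
Proof.
by move: WW' => [_ _ WK _]; apply/funext => v; rewrite /conj_op /= WK.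
Qed.

Lemma bounded_conj_op x : bounded_op x -> bounded_op (Ad x).
Proof.
move: WW' (unitary_pair_sym WW') => [Wl Wn _ _] [W'l W'n _ _] [xl [M xM]].
split; first by move=> k u v; rewrite /conj_op /= W'l xl Wl.
by exists M => v; rewrite /conj_op /= Wn -(W'n v).
Qed.

Lemma opnorm_conj_op x : opnorm (Ad x) = opnorm x.
Proof.
move: WW' (unitary_pair_sym WW') => [_ Wn WK _] [_ W'n _ _].
rewrite /opnorm; congr (sup _); apply/seteqP; split => _ [v /= v1 <-].
  by exists (W' v); [rewrite /= W'n | rewrite /conj_op /= Wn].
by exists (W v); [rewrite /= Wn | rewrite /conj_op /= Wn WK].
Qed.

Lemma dotp_unitary u v : dotp (W u) v = dotp u (W' v).
Proof.
move: WW' => [Wl Wn _ W'K].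
by rewrite -(norm_preserving_dotp Wl Wn) W'K.
Qed.

End Conjugation.

(** An adjoint of [x] conjugates to one of the conjugate, and back. So either both adjoints exist
    and correspond, or both sides are the default 0. *)
Lemma adjoint_conj_op F G (W : F -> G) W' x : unitary_pair W W' ->
  adjoint (conj_op W W' x) = conj_op W W' (adjoint x).
Proof.
move=> WW'; have W'W := unitary_pair_sym WW'.
have adj F1 G1 (V : F1 -> G1) V' T S : unitary_pair V V' ->
    (forall u v, dotp (T u) v = dotp u (S v)) ->
    forall u v, dotp (conj_op V V' T u) v = dotp u (conj_op V V' S v).
  move=> VV' TS u v; rewrite /conj_op /= (dotp_unitary VV') TS.
  by rewrite -(dotp_unitary (unitary_pair_sym VV')).
have [[S xS]|xN] := pselect (exists S, forall u v, dotp (x u) v = dotp u (S v)).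
  by rewrite (adjointE xS); apply: adjointE; exact: adj.
rewrite {2}/adjoint xgetPN; last by move=> S xS; apply: xN; exists S.
rewrite (conj_op0 WW') /adjoint xgetPN// => S xS; apply: xN.
by exists (conj_op W' W S); rewrite -(conj_opK WW' x); exact: adj.
Qed.

End UnitaryConjugation.

(** * Transport of the peripheral boundary and of its product *)

Section PeripheralBoundary.
Context {R : realType}.
Implicit Types F G : hilbertType R.

(** [tau] acts on all functions, so stability of B(F), on which its iteration relies, is a separate
    property. *)
Definition preserves_bounded F (tau : (F -> F) -> F -> F) :=
  forall x, bounded_op x -> bounded_op (tau x).

Section ChoiEffrosUnique.
Variables (F : hilbertType R) (tau : (F -> F) -> F -> F).
Local Notation P := (peripheral_boundary tau).
Local Notation span := (lspan (\bigcup_(lam in [set z : R[i] | `|z| = 1])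
    eigenoperators tau lam)).

(** Adding one eigenoperator at a time, in the shape [k *: x + y] of the linearity clauses of
    [is_choi_effros]. *)
Lemma span_eigenoperators_ind (Q : (F -> F) -> Prop) :
  Q 0 ->
  (forall k lam x y, `|lam| = 1 -> eigenoperators tau lam x -> span y -> Q y ->
    Q (k *: x + y)) ->
  forall x, span x -> Q x.
Proof.
move=> Q0 QS x [n [c [a [aE ->]]]]; elim: n c a aE => [|n IH] c a aE.
  by rewrite big_ord0.
have [lam lam1 alam] := aE ord0.
rewrite big_ord_recl; apply: QS lam1 alam _ _; last exact: IH.
by exists n, (fun i => c (lift ord0 i)), (fun i => a (lift ord0 i)).
Qed.

Lemma span_eigenoperators_boundary x : span x -> P x.
Proof.
move=> xs; split.
  elim/span_eigenoperators_ind: x / xs; first exact: bounded_op0.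
  by move=> k lam x y _ [xb _] _; exact: bounded_op_lin.
move=> eps eps0; exists x => //; rewrite subrr.
suff -> : opnorm (0 : F -> F) = 0 by [].
rewrite /opnorm (_ : [set _ | _ in _] = [set 0]) ?sup1//.
apply/seteqP; split => [_ [v _ <-]|_ ->]; first by rewrite normr0.
by exists 0; rewrite /= ?normr0.
Qed.

Lemma eigenoperators_boundary lam x :
  `|lam| = 1 -> eigenoperators tau lam x -> P x.
Proof.
move=> lam1 xlam; apply: span_eigenoperators_boundary.
exists 1%N, (fun=> 1), (fun=> x); split; first by move=> _; exists lam.
by rewrite big_ord1 scale1r.
Qed.

(** Strong limits fix the product on eigenoperators, bilinearity extends this to their span, and
    joint continuity to the closure. *)
Lemma is_choi_effros_unique c1 c2 :
  is_choi_effros tau c1 -> is_choi_effros tau c2 ->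
  forall x y, P x -> P y -> c1 x y = c2 x y.
Proof.
move=> [c1P c1l c1r c1c c1E] [c2P c2l c2r c2c c2E].
have P0 : P 0 by apply: span_eigenoperators_boundary; exists 0%N, (fun=> 0), (fun=> 0);
  split => [[]//|]; rewrite big_ord0.
(* Linearity is only available on [P]; with coefficient -1 and zero operators it gives
   [c 0 y = - c 0 y + c 0 y]. *)
have l0 (c : (F -> F) -> (F -> F) -> F -> F) : (forall (a : R[i]) x x' y, P x -> P x' -> P y ->
        c (a *: x + x') y = a *: c x y + c x' y) ->
    forall y, P y -> c 0 y = 0.
  move=> cl y Py; have := cl (-1) 0 0 y P0 P0 Py.
  by rewrite scaler0 add0r scaleN1r addNr.
have r0 (c : (F -> F) -> (F -> F) -> F -> F) : (forall (a : R[i]) x y y', P x -> P y -> P y' ->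
        c x (a *: y + y') = a *: c x y + c x y') ->
    forall x, P x -> c x 0 = 0.
  move=> cr x Px; have := cr (-1) x 0 0 Px P0 P0.
  by rewrite scaler0 add0r scaleN1r addNr.
have spanE x y : span x -> span y -> c1 x y = c2 x y.
  move=> xs ys; have Py := span_eigenoperators_boundary ys.
  elim/span_eigenoperators_ind: x / xs; first by rewrite !l0.
  move=> k lam x x' lam1 xlam x's IHx.
  have Px := eigenoperators_boundary lam1 xlam.
  have Px' := span_eigenoperators_boundary x's.
  rewrite c1l// c2l// IHx; congr (_ *: _ + _) => {x' x's IHx Px'}.
  elim/span_eigenoperators_ind: y / ys Py; first by rewrite !r0.
  move=> h mu y y' mu1 ymu y's IHy _.
  have Py := eigenoperators_boundary mu1 ymu.
  have Py' := span_eigenoperators_boundary y's.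
  rewrite c1r// c2r// IHy//; congr (_ *: _ + _).
  apply/funext => v.
  by apply: (cvg_unique (@norm_hausdorff _ _)) (c1E _ _ _ _ _ _ xlam ymu v)
    (c2E _ _ _ _ _ _ xlam ymu v).
move=> x y Px Py; apply: opnorm_small_eq.
- by have [[]] := c1P _ _ Px Py.
- by have [[]] := c2P _ _ Px Py.
move=> eps v eps0 v1; have e20 : 0 < eps / 2 by rewrite divr_gt0.
have [d1 d10 cd1] := c1c _ _ Px Py _ e20.
have [d2 d20 cd2] := c2c _ _ Px Py _ e20.
(* The minimum lets a single pair [x'], [y'] from the span approximate for both products, which
   agree there. *)
have d0 : 0 < Num.min d1 d2 by rewrite lt_min d10.
have [_ /(_ _ d0)[x' x's]] := Px; rewrite opnorm_distC lt_min => /andP[x1 x2].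
have [_ /(_ _ d0)[y' y's]] := Py; rewrite opnorm_distC lt_min => /andP[y1 y2].
have [Px' Py'] := (span_eigenoperators_boundary x's, span_eigenoperators_boundary y's).
have [[b1 _] [b2 _]] := (c1P _ _ Px Py, c2P _ _ Px Py).
have [b' _] := c1P _ _ Px' Py'.
have := ltW (cd1 _ _ Px' Py' x1 y1); have := ltW (cd2 _ _ Px' Py' x2 y2).
rewrite -spanE// => /(le_trans (opnorm_ge (bounded_opB b' b2) v1)) n2.
move=> /(le_trans (opnorm_ge (bounded_opB b' b1) v1)) n1.
rewrite (splitr eps) (le_trans _ (lerD n1 n2))//.
rewrite !addrfctE !opprfctE -raddfD /=.
have : `|c1 x y v - c2 x y v| <= `|c1 x' y' v - c1 x y v| + `|c1 x' y' v - c2 x y v|.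
  by rewrite [X in _ <= X + _]distrC ler_distD.
by rewrite lecE => /andP[].
Qed.

End ChoiEffrosUnique.

Section ConjugationInvariance.
Variables (F G : hilbertType R) (W : F -> G) (W' : G -> F).
Hypothesis WW' : unitary_pair W W'.
Variables (tau : (F -> F) -> F -> F) (tau' : (G -> G) -> G -> G).
Hypothesis tau_bounded : preserves_bounded tau.
Local Notation Ad := (conj_op W W').
Local Notation Ad' := (conj_op W' W).
Hypothesis tauE : forall x, bounded_op x -> tau' (Ad x) = Ad (tau x).

Lemma eigenoperators_conj_op lam x :
  eigenoperators tau lam x -> eigenoperators tau' lam (Ad x).
Proof.
move=> [xb xlam]; split; first exact: bounded_conj_op.
by rewrite tauE// xlam conj_opZ.
Qed.

(** Conjugation keeps eigenvalues, is linear and preserves [opnorm], so it respects closed spans. *)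
Lemma peripheral_boundary_conj_op x :
  peripheral_boundary tau x -> peripheral_boundary tau' (Ad x).
Proof.
move=> [xb xc]; split; first exact: bounded_conj_op.
move=> eps /xc[y [n [c [a [aE ->]]]] yx].
exists (Ad (\sum_(i < n) c i *: a i)); last by rewrite -conj_opB// opnorm_conj_op.
exists n, c, (fun i => Ad (a i)); split.
  by move=> i; have [lam lam1 /eigenoperators_conj_op] := aE i; exists lam.
have AdD : {morph Ad : s t / s + t >-> s + t}.
  by move=> s t; have := conj_op_lin WW' 1 s t; rewrite !scale1r.
rewrite (big_morph Ad AdD (conj_op0 WW')); apply: eq_bigr => i _.
by rewrite conj_opZ.
Qed.

Lemma iter_conj_op m x : bounded_op x -> iter m tau' (Ad x) = Ad (iter m tau x).
Proof.
move=> xb; elim: m => //= m ->; rewrite tauE//.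
by elim: m => //= m; exact: tau_bounded.
Qed.

End ConjugationInvariance.

(** Each clause is pulled back to [tau] by the inverse conjugation, which maps boundary to boundary
    isometrically. *)
Lemma is_choi_effros_conj_op F G (W : F -> G) W' tau tau' c :
  unitary_pair W W' ->
  preserves_bounded tau ->
  (forall x, bounded_op x -> tau' (conj_op W W' x) = conj_op W W' (tau x)) ->
  (forall y, bounded_op y -> tau (conj_op W' W y) = conj_op W' W (tau' y)) ->
  is_choi_effros tau c ->
  is_choi_effros tau'
    (fun x y => conj_op W W' (c (conj_op W' W x) (conj_op W' W y))).
Proof.
move=> WW' taub tauE tau'E [cP cl cr cc cE].
have W'W := unitary_pair_sym WW'.
have P'P := peripheral_boundary_conj_op W'W tau'E.
split.
- by move=> x y /P'P Px /P'P Py; exact: (peripheral_boundary_conj_op WW' tauE (cP _ _ Px Py)).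
- move=> a x x' y /P'P Px /P'P Px' /P'P Py.
  by rewrite (conj_op_lin W'W) cl// (conj_op_lin WW').
- move=> a x y y' /P'P Px /P'P Py /P'P Py'.
  by rewrite (conj_op_lin W'W) cr// (conj_op_lin WW').
- move=> x y /P'P Px /P'P Py eps /(cc _ _ Px Py)[d d0 cd].
  exists d => // x' y' /P'P Px' /P'P Py' x'x y'y.
  rewrite -(conj_opB WW') (opnorm_conj_op WW'); apply: cd => //.
    by rewrite -(conj_opB W'W) (opnorm_conj_op W'W).
  by rewrite -(conj_opB W'W) (opnorm_conj_op W'W).
- move=> lam mu x y lam1 mu1 xlam ymu v; have [Wl Wn _ _] := WW'.
  have [[xb _] [yb _]] := (xlam, ymu).
  have xlam' := eigenoperators_conj_op W'W tau'E xlam.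
  have ymu' := eigenoperators_conj_op W'W tau'E ymu.
  (* The orbit at [v] is the image under [W] of the orbit for [tau] at [W' v]; the isometry [W] then
     carries the strong limit across. *)
  have -> : (fun m => (lam * mu) ^- m *: iter m tau' (x \o y) v) =
      (fun m => W ((lam * mu) ^- m *:
        iter m tau (conj_op W' W x \o conj_op W' W y) (W' v))).
    apply/funext => m; rewrite -(conj_op_comp W'W) (linear_funZ _ _ Wl); congr (_ *: _).
    rewrite -[X in iter m tau' X v](conj_opK W'W) (iter_conj_op taub tauE)//.
    by apply: bounded_conj_op => //; exact: bounded_op_comp.
  exact: isometry_cvg (cE _ _ _ _ lam1 mu1 xlam' ymu' (W' v)).
Qed.

(* No existence of the Choi-Effros product is needed: if neither side has one,
   both products are the default 0. *)
Lemma choi_effros_conj_op F G (W : F -> G) W' tau tau' x y :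
  unitary_pair W W' ->
  preserves_bounded tau -> preserves_bounded tau' ->
  (forall x, bounded_op x -> tau' (conj_op W W' x) = conj_op W W' (tau x)) ->
  (forall y, bounded_op y -> tau (conj_op W' W y) = conj_op W' W (tau' y)) ->
  peripheral_boundary tau x -> peripheral_boundary tau y ->
  conj_op W W' (choi_effros tau x y) =
  choi_effros tau' (conj_op W W' x) (conj_op W W' y).
Proof.
move=> WW' taub tau'b tauE tau'E Px Py; have W'W := unitary_pair_sym WW'.
have [[c tauc]|tauN] := pselect (exists c, is_choi_effros tau c).
  have ce : is_choi_effros tau (choi_effros tau) by apply: xgetPex; exists c.
  (* The transported product and the chosen one both qualify for [tau'], so uniqueness identifies
     them on the boundary. *)
  have ce1 := is_choi_effros_conj_op WW' taub tauE tau'E ce.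
  have ce' : is_choi_effros tau' (choi_effros tau') by apply: xgetPex; eexists; exact: ce1.
  rewrite -(is_choi_effros_unique ce1 ce') ?(conj_opK WW')//.
    exact: (peripheral_boundary_conj_op WW' tauE Px).
  exact: (peripheral_boundary_conj_op WW' tauE Py).
rewrite /choi_effros !xgetPN ?conj_op0// => c ce; apply: tauN.
  by eexists; exact: is_choi_effros_conj_op W'W tau'b tau'E tauE ce.
by exists c.
Qed.

(** Conjugation is the isomorphism. Conjugating back first yields the reverse intertwining relation,
    then stability of bounded operators under [tau']. *)
Lemma cstar_isomorphic_conj_op F G (W : F -> G) W' tau tau' :
  unitary_pair W W' -> preserves_bounded tau ->
  (forall x, bounded_op x -> tau' (conj_op W W' x) = conj_op W W' (tau x)) ->
  cstar_isomorphic (peripheral_boundary tau) (choi_effros tau)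
    (peripheral_boundary tau') (choi_effros tau').
Proof.
move=> WW' taub tauE; have W'W := unitary_pair_sym WW'.
have tau'E y : bounded_op y -> tau (conj_op W' W y) = conj_op W' W (tau' y).
  move=> yb; rewrite -[in RHS](conj_opK W'W y) tauE ?(conj_opK WW')//.
  exact: bounded_conj_op.
have tau'b : preserves_bounded tau'.
  move=> y yb; rewrite -(conj_opK W'W (tau' y)) -tau'E//.
  by apply: bounded_conj_op WW' _ _; apply: taub; exact: bounded_conj_op.
exists (conj_op W W'); split.
  split.
  - by move=> x /(peripheral_boundary_conj_op WW' tauE).
  - by move=> x y _ _; exact: (can_inj (conj_opK WW')).
  - move=> y Py; exists (conj_op W' W y); last exact: conj_opK.
    exact: (peripheral_boundary_conj_op W'W tau'E Py).
split.
- by move=> a x y _ _; exact: conj_op_lin.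
- by move=> x y Px Py; exact: choi_effros_conj_op.
- by move=> x _; rewrite (adjoint_conj_op _ WW').
- exact: conj_op_id.
- by move=> x _; exact: opnorm_conj_op.
Qed.

End PeripheralBoundary.

(** * Operators determined on total families; adjoints of isometries *)

Section TotalFamilies.
Context {R : realType}.
Implicit Types E F H : hilbertType R.

Lemma linear_lcomb E F (T : E -> F) I (a : I -> E) s :
  linear T -> T (lcomb a s) = lcomb (T \o a) s.
Proof.
move=> Tl; elim: s => [|p s IH]; first by rewrite /lcomb !big_nil linear_fun0.
by rewrite /lcomb !big_cons Tl; congr (_ + _).
Qed.

(** The difference vanishes on combinations of [a] and is at most [|M| + |N|] times the distance to
    one of them; the extra 1 in the proof keeps the divisor positive. *)
Lemma linear_eq_on_total E F (S T : E -> F) (M N : R[i]) I (a : I -> E) :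
  total_family a -> linear S -> linear T ->
  (forall v, `|S v| <= M * `|v|) -> (forall v, `|T v| <= N * `|v|) ->
  (forall i, S (a i) = T (a i)) -> S = T.
Proof.
move=> atot Sl Tl SM TN ST; apply/funext => v; apply/eqP.
rewrite -subr_eq0 -normr_le0; apply/ler_addgt0Pr => e e0; rewrite add0r.
have D0 : 0 < `|M| + `|N| + 1 by rewrite ltr_wpDl// addr_ge0.
have [s vs] : exists s, `|v - lcomb a s| < e / (`|M| + `|N| + 1).
  by apply: atot; rewrite divr_gt0.
rewrite ltr_pdivlMr// in vs; apply: le_trans (ltW vs).
have Sv k : k = S (lcomb a s) -> S v - k = S (v - lcomb a s).
  by move=> ->; rewrite (linear_funB _ _ Sl).
have eqs : S (lcomb a s) = T (lcomb a s).
  by rewrite (linear_lcomb _ _ Sl) (linear_lcomb _ _ Tl); congr lcomb; apply/funext.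
rewrite (_ : S v - T v = S (v - lcomb a s) - T (v - lcomb a s)); last first.
  by rewrite (linear_funB _ _ Sl) (linear_funB _ _ Tl) eqs opprB addrA subrK.
have abs (x y : R[i]) (z : E) : y <= x * `|z| -> 0 <= y -> y <= `|x| * `|z|.
  move=> yx y0; apply: (le_trans yx); have := le_trans y0 yx.
  by move=> /ger0_norm <-; rewrite normrM normr_id.
rewrite (le_trans (ler_normB _ _))// mulrDr mulr1 mulrDr ler_wpDr//.
by rewrite lerD// mulrC abs.
Qed.

Lemma norm_preserving_le E F (T : E -> F) :
  (forall v, `|T v| = `|v|) -> forall v, `|T v| <= 1 * `|v|.
Proof. by move=> Tn v; rewrite Tn mul1r. Qed.

(** The isometries obtained in the two directions compose to maps fixing a total family, hence to
    identities. *)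
Lemma gram_unitary E F I (a : I -> E) (b : I -> F) :
  (forall i j, dotp (a i) (a j) = dotp (b i) (b j)) ->
  total_family a -> total_family b ->
  exists W W', unitary_pair W W' /\ forall i, W (a i) = b i.
Proof.
move=> gram atot btot.
have [W [Wl Wn Wa]] := gram_isometry gram atot.
have [W' [W'l W'n W'b]] := gram_isometry (fun i j => esym (gram i j)) btot.
have idK (G : hilbertType R) : linear (@idfun G) by [].
exists W, W'; split=> //; split => // v.
- suff /(congr1 (@^~ v)) : W' \o W = idfun by [].
  apply: (linear_eq_on_total (M := 1) (N := 1) atot) => //.
  + by move=> k u w /=; rewrite Wl W'l.
  + by move=> u /=; rewrite W'n Wn mul1r.
  + by move=> u /=; rewrite mul1r.
  + by move=> i /=; rewrite Wa W'b.
- suff /(congr1 (@^~ v)) : W \o W' = idfun by [].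
  apply: (linear_eq_on_total (M := 1) (N := 1) btot) => //.
  + by move=> k u w /=; rewrite W'l Wl.
  + by move=> u /=; rewrite Wn W'n mul1r.
  + by move=> u /=; rewrite mul1r.
  + by move=> i /=; rewrite W'b Wa.
Qed.

(** If an adjoint [S] exists, [T (S v)] is the orthogonal projection of [v] onto the range of [T],
    and Pythagoras bounds its norm, which is that of [S v]. Otherwise [adjoint T] is the default 0,
    also a linear contraction. *)
Lemma adjoint_isometry_contraction E (T : E -> E) :
  linear T -> (forall v, `|T v| = `|v|) ->
  linear (adjoint T) /\ forall v, `|adjoint T v| <= `|v|.
Proof.
move=> Tl Tn; have [[S TS]|TN] := pselect (exists S, forall u v, dotp (T u) v = dotp u (S v)).
  rewrite (adjointE TS); split.
    move=> k u v; apply: dotp_nondegenerate => w.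
    rewrite -TS !linearDr !linearZr_LR.
    by congr (_ * _ + _); exact: TS.
  move=> v; rewrite -(@ler_pXn2r _ 2)// ?nnegrE//.
  have orth : dotp (T (S v)) (v - T (S v)) = 0.
    apply/eqP; rewrite linearBr subr_eq0; apply/eqP.
    exact: etrans (TS _ _) (esym (norm_preserving_dotp Tl Tn _ _)).
  have pyth : dotp v v =
      dotp (T (S v)) (T (S v)) + dotp (v - T (S v)) (v - T (S v)).
    by have := hnormDd orth; rewrite addrC subrK.
  by rewrite -(Tn (S v)) !sqr_norm_dotp pyth lerDl dnorm_ge0.
rewrite /adjoint xgetPN; last by move=> S TS; apply: TN; exists S.
by split => [k u v|v]; rewrite ?scaler0 ?addr0// normr0.
Qed.

End TotalFamilies.

(** * Convergence of vector series dominated by the weights *)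

Section WeightedSeries.
Context {R : realType} {V : completeNormedModType R[i]}.

Lemma weighted_series_cvg (P : pred nat) (omega : nat -> R) (u : nat -> V) (K : R[i]) :
  (forall i, P i -> 0 <= omega i) ->
  cvg (\sum_(0 <= i < m | P i) omega i @[m --> \oo]) ->
  0 <= K -> (forall i, P i -> `|u i| <= (omega i)%:C%C * K) ->
  cvg (\sum_(0 <= i < m | P i) u i @[m --> \oo]).
Proof.
move=> omega0 omega_cvg K0 uK; apply: cauchy_cvg.
(* Extension by zero turns the filtered sums into [series], to which the Cauchy criterion
   applies. *)
pose w i := if P i then omega i else 0.
have -> : (fun m => \sum_(0 <= i < m | P i) u i) = series (fun i => if P i then u i else 0).
  by apply/funext => m; rewrite big_mkcond.
have wE : (fun m => \sum_(0 <= i < m | P i) omega i) = series w.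
  by apply/funext => m; rewrite big_mkcond.
rewrite wE in omega_cvg; apply/cauchy_seriesP => e e0.
have K1 : 0 < K + 1 by rewrite ltr_wpDl.
have eK : 0 < e / (K + 1) by rewrite divr_gt0.
(* The weights are summed in [R], so the tolerance, a positive element of [R[i]], is replaced by its
   real part. *)
have d0 : 0 < complex.Re (e / (K + 1)) by move: eK; rewrite ltcE => /andP[].
have dE : (complex.Re (e / (K + 1)))%:C%C = e / (K + 1) by rewrite RRe_real ?gtr0_real.
have /cvg_cauchy/cauchy_seriesP/(_ _ d0) := omega_cvg.
apply: filterS => -[m n] /= wd.
rewrite (le_lt_trans (ler_norm_sum _ _ _))//.
apply: (@le_lt_trans _ _ ((\sum_(m <= k < n) w k)%:C%C * K)).
  rewrite rmorph_sum mulr_suml ler_sum// => k _; rewrite /w.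
  by case: ifPn => [/uK//|_]; rewrite normr0 rmorph0 mul0r.
apply: (@le_lt_trans _ _ ((complex.Re (e / (K + 1)))%:C%C * K)).
  rewrite ler_wpM2r// lecR (le_trans (ler_norm _))// ltW//.
rewrite dE mulrAC ltr_pdivrMr// ltr_pM2l// ltrDl//.
Qed.

End WeightedSeries.

(** * Creation operators, second quantization and the map P_omega *)

Section FockSpace.
Context {R : realType} {H F : hilbertType R} {tens : seq H -> F}.
Hypothesis fock : full_fock_space tens.

Let tens_total : total_family tens.
Proof. by move: fock => [_ /total_family_range]. Qed.

Lemma left_creationE xi (T : F -> F) :
  bounded_op T -> (forall s, T (tens s) = tens (xi :: s)) ->
  left_creation tens xi = T.
Proof.
move=> Tb Ttens; apply: xget_subset1 => // S1 S2 [[S1l [M1 S1M]] S1t] [[S2l [M2 S2M]] S2t].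
by apply: (linear_eq_on_total tens_total S1l S2l S1M S2M) => s; rewrite S1t S2t.
Qed.

(** Prefixing a unit vector multiplies each inner product of elementary tensors of equal length by
    1, so the Gram matrix is unchanged and [gram_isometry] applies. *)
Lemma left_creation_isometry xi : dotp xi xi = 1 ->
  [/\ linear (left_creation tens xi), forall v, `|left_creation tens xi v| = `|v| &
    forall s, left_creation tens xi (tens s) = tens (xi :: s)].
Proof.
move=> xi1; have [gramE _] := fock.
have gram s t : dotp (tens s) (tens t) = dotp (tens (xi :: s)) (tens (xi :: t)).
  by rewrite !gramE /= eqSS big_cons /= xi1 mul1r.
have [L [Ll Ln Lt]] := gram_isometry gram tens_total.
suff -> : left_creation tens xi = L by [].
by apply: left_creationE => //; split=> //; exists 1; exact: norm_preserving_le.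
Qed.

(** [U] preserves every factor of the inner products. The images are total because each [tens s] is
    the image of [tens (map U' s)]. *)
Lemma second_quantization (U U' : H -> H) : unitary_pair U U' ->
  exists W W', unitary_pair W W' /\ forall s, W (tens s) = tens (map U s).
Proof.
move=> [Ul Un UK U'K]; have [gramE _] := fock; apply: gram_unitary => //.
- move=> s t; rewrite !gramE !size_map; case: ifP => // _.
  have -> : zip (map U s) (map U t) = [seq (U p.1, U p.2) | p <- zip s t].
    by elim: s t => [|x s IH] [|y t] //=; rewrite IH.
  by rewrite big_map; apply: eq_bigr => p _; rewrite (norm_preserving_dotp Ul Un).
- move=> v eps /(tens_total v)[s vs].
  exists [seq (p.1, map U' p.2) | p <- s].
  rewrite /lcomb big_map [X in _ - X](_ : _ = lcomb tens s)//.
  by apply: eq_bigr => p _ /=; rewrite (mapK U'K).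
Qed.

(** On [tens s], [W'] undoes [U] in every factor, [xi] is prefixed, and [W] restores the factors
    while turning [xi] into [U xi]. *)
Lemma left_creation_conj_op (U : H -> H) (W W' : F -> F) xi :
  unitary_pair W W' -> (forall s, W (tens s) = tens (map U s)) ->
  bijective U -> dotp xi xi = 1 ->
  left_creation tens (U xi) = conj_op W W' (left_creation tens xi).
Proof.
move=> WW' Wt [U' UK U'K] xi1; have [Ll Ln Lt] := left_creation_isometry xi1.
apply: left_creationE.
  apply: bounded_conj_op WW' _ _; split => //.
  by exists 1; exact: norm_preserving_le.
have [_ _ WK W'K] := WW'.
move=> s; rewrite /conj_op /=; have -> : W' (tens s) = tens (map U' s).
  by apply: (can_inj WK); rewrite W'K Wt (mapK U'K).
by rewrite Lt Wt /= (mapK U'K).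
Qed.

Section WeightedCompression.
Variables (Theta : set nat) (omega : nat -> R) (e : nat -> H).
Hypothesis omega_ge0 : forall i, Theta i -> 0 <= omega i.
Hypothesis omega_cvg : cvg (\sum_(0 <= i < m | i \in Theta) omega i @[m --> \oo]).
Hypothesis e_unit : forall i, Theta i -> dotp (e i) (e i) = 1.

Let term (x : F -> F) (v : F) i := (omega i)%:C%C *:
  adjoint (left_creation tens (e i)) (x (left_creation tens (e i) v)).

Let term_linear x k u v i : Theta i -> linear x ->
  term x (k *: u + v) i = k *: term x u i + term x v i.
Proof.
move=> /e_unit /left_creation_isometry[Ll Ln _] xl.
have [L'l _] := adjoint_isometry_contraction Ll Ln.
by rewrite /term Ll xl L'l scalerDr !scalerA mulrC.
Qed.

Let term_le x (M : R[i]) v i : Theta i -> (forall u, `|x u| <= M * `|u|) ->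
  `|term x v i| <= (omega i)%:C%C * (M * `|v|).
Proof.
move=> Ti xM; have [Ll Ln _] := left_creation_isometry (e_unit Ti).
have [_ L'n] := adjoint_isometry_contraction Ll Ln.
have o0 : 0 <= (omega i)%:C%C :> R[i] by rewrite lecR omega_ge0.
rewrite normrZ (ger0_norm o0) ler_wpM2l// (le_trans (L'n _))//.
by rewrite (le_trans (xM _))// Ln.
Qed.

(** Shows that the [lim] in the definition is a genuine limit: creation by a unit vector is
    isometric and its adjoint contracts, so the weights dominate. *)
Lemma weighted_compression_cvg x v : bounded_op x ->
  \sum_(0 <= i < m | i \in Theta) term x v i @[m --> \oo] -->
    weighted_compression tens Theta omega e x v.
Proof.
move=> xb; have [M M0 xM] := bounded_op_ge0 xb.
apply: (weighted_series_cvg (omega := omega) (K := M * `|v|)) => //.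
- by move=> i; rewrite inE; exact: omega_ge0.
- by rewrite mulr_ge0.
- by move=> i; rewrite inE => Ti; exact: term_le.
Qed.

Lemma weighted_compression_bounded :
  preserves_bounded (weighted_compression tens Theta omega e).
Proof.
move=> x xb; have [xl _] := xb; split.
  move=> k u v; apply: cvg_lim; first exact: norm_hausdorff.
  have -> : (fun m => \sum_(0 <= i < m | i \in Theta) term x (k *: u + v) i) =
      (fun m => k *: \sum_(0 <= i < m | i \in Theta) term x u i +
        \sum_(0 <= i < m | i \in Theta) term x v i).
    apply/funext => m; rewrite scaler_sumr -big_split /=.
    by apply: eq_bigr => i; rewrite inE => Ti; exact: term_linear.
  apply: cvgD; last exact: weighted_compression_cvg.
  by apply: cvgZ; [exact: cvg_cst | exact: weighted_compression_cvg].
have [M M0 xM] := bounded_op_ge0 xb.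
(* The total weight [B] times a bound for [x] bounds every partial sum; a partial sum within [eps]
   of the limit passes the bound on. *)
pose B := lim (\sum_(0 <= i < m | i \in Theta) omega i @[m --> \oo]).
have omegaB m : \sum_(0 <= i < m | i \in Theta) omega i <= B.
  apply: (nondecreasing_cvgn_le (u_ := fun m => \sum_(0 <= i < m | i \in Theta) omega i)) => //.
  by apply/nondecreasing_seqP => n; rewrite big_mkcond [leRHS]big_mkcond big_nat_recr//= lerDl;
    case: ifPn => //; rewrite inE; exact: omega_ge0.
exists (B%:C%C * M) => v; apply/ler_addgt0Pr => eps eps0.
have /cvgrPdist_lt/(_ _ eps0)[N _ /(_ N (leqnn N)) /= dN] :=
  @weighted_compression_cvg x v xb.
set S := (\sum_(_ <= _ < _ | _) _) in dN.
rewrite addrC -[X in `|X| <= _](subrK S) (le_trans (ler_normD _ _))//.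
rewrite lerD ?(ltW dN)// /S (le_trans (ler_norm_sum _ _ _))//.
apply: (@le_trans _ _ (\sum_(0 <= i < N | i \in Theta) (omega i)%:C%C * (M * `|v|))).
  by apply: ler_sum => i; rewrite inE => Ti; exact: term_le.
by rewrite -mulr_suml -rmorph_sum -mulrA ler_wpM2r ?mulr_ge0// lecR.
Qed.

(** Term by term, [W] maps the series for [e] at [W' v] to the series for [f] at [v]; convergence of
    the former gives that of the latter. *)
Lemma weighted_compression_conj_op (U : H -> H) (f : nat -> H) (W W' : F -> F) x :
  unitary_pair W W' -> (forall s, W (tens s) = tens (map U s)) ->
  bijective U -> (forall i, Theta i -> U (e i) = f i) -> bounded_op x ->
  weighted_compression tens Theta omega f (conj_op W W' x) =
  conj_op W W' (weighted_compression tens Theta omega e x).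
Proof.
move=> WW' Wt Ubij Uef xb; have [Wl Wn WK _] := WW'; apply/funext => v.
have WD : {morph W : u w / u + w >-> u + w}.
  by move=> u w; have := Wl 1 u w; rewrite !scale1r.
apply: cvg_lim; first exact: norm_hausdorff.
rewrite (_ : (fun m => _) =
    (fun m => W (\sum_(0 <= i < m | i \in Theta) term x (W' v) i))); last first.
  apply/funext => m; rewrite (big_morph W WD (linear_fun0 Wl)).
  apply: eq_bigr => i; rewrite inE => Ti.
  rewrite -(Uef _ Ti) (left_creation_conj_op WW' Wt)//; last exact: e_unit.
  by rewrite (adjoint_conj_op _ WW') /conj_op /= !WK /term (linear_funZ _ _ Wl).
by apply: isometry_cvg => //; exact: weighted_compression_cvg.
Qed.

End WeightedCompression.
End FockSpace.

(** * From two orthonormal bases to the isomorphism *)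

(** The index is the subtype because [e] is unconstrained outside [Theta], where the Gram matrices
    of two bases may differ. *)
Lemma orthonormal_basis_total (R : realType) (H : hilbertType R)
    (Theta : set nat) (e : nat -> H) :
  orthonormal_basis Theta e ->
  total_family (fun i : {i | Theta i} => e (sval i)).
Proof.
move=> [_ eT]; apply: total_family_range; rewrite -eT; congr (closure (lspan _)).
apply/seteqP; split => [_ [i _ <-]|_ [i Ti <-]].
  by exists (sval i); first exact: svalP.
by exists (exist _ i Ti).
Qed.

Theorem mainTheorem5 (R : realType) (H F : hilbertType R)
    (tens : seq H -> F) (Theta : set nat) (omega : nat -> R) (e f : nat -> H) :
  full_fock_space tens ->
  (exists2 n : nat, (1 < n)%N & Theta = `I_n) \/ Theta = setT ->
  (forall i, Theta i -> 0 < omega i) ->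
  \sum_(0 <= i < m | i \in Theta) omega i @[m --> \oo] --> (1 : R) ->
  orthonormal_basis Theta e ->
  orthonormal_basis Theta f ->
  let P := weighted_compression tens Theta omega e in
  let P' := weighted_compression tens Theta omega f in
  cstar_isomorphic (peripheral_boundary P) (choi_effros P)
    (peripheral_boundary P') (choi_effros P').
Proof.
move=> fock _ omega_gt0 omega1 eB fB P P'.
have omega_ge0 i : Theta i -> 0 <= omega i by move=> /omega_gt0/ltW.
have omega_cvg : cvg (\sum_(0 <= i < m | i \in Theta) omega i @[m --> \oo]).
  by apply/cvg_ex; exists 1.
have e_unit i : Theta i -> dotp (e i) (e i) = 1.
  by move=> Ti; have [-> //] := eB; rewrite eqxx.
have gram (i j : {i | Theta i}) :
    dotp (e (sval i)) (e (sval j)) = dotp (f (sval i)) (f (sval j)).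
  have [eO _] := eB; have [fO _] := fB.
  by rewrite (eO _ _ (svalP i) (svalP j)) (fO _ _ (svalP i) (svalP j)).
have [U [U' [UU' Uef]]] :=
  gram_unitary gram (orthonormal_basis_total eB) (orthonormal_basis_total fB).
have [W [W' [WW' Wt]]] := second_quantization fock UU'.
have [_ _ UK U'K] := UU'.
apply: (cstar_isomorphic_conj_op WW').
  exact: weighted_compression_bounded.
move=> x xb; apply: (weighted_compression_conj_op fock omega_ge0 omega_cvg e_unit WW' Wt) => //.
  by exists U'.
by move=> i Ti; exact: (Uef (exist _ i Ti)).
Qed.
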